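(* Let $G$ be a totally disconnected, locally compact group, let $\alpha:G\to G$ be an endomorphism and let $V$ be a compact, open subgroup of $G$. Then $$s(\alpha)=\lim_{n\to\infty}[\alpha^n(V):V\cap\alpha^n(V)]^{\frac{1}{n}}.$$
   Context: An endomorphism of $G$ is a continuous homomorphism $\alpha:G\to G$. The scale of $\alpha$ is $s(\alpha)=\min\{[\alpha(U):\alpha(U)\cap U] \mid U\leq G \text{ compact and open}\}$ (these indices are finite). *)

(* Defs.v *)
From HB Require Import structures.
From mathcomp Require Import all_boot all_order all_algebra finmap.
From mathcomp Require Import all_classical all_reals all_analysis.
Import numFieldNormedType.Exports.

Set Implicit Arguments.
Unset Strict Implicit.
Unset Printing Implicit Defensive.

Local Open Scope classical_set_scope.
Local Open Scope group_scope.

HB.mixin Record isTopologicalGroup G & Topological G & Group G := {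
  mulg_continuous : continuous (fun x : G * G => x.1 * x.2);
  invg_continuous : continuous (fun x : G => x^-1)
}.

#[short(type="topologicalGroupType")]
HB.structure Definition TopologicalGroup :=
  {G of Topological G & Group G & isTopologicalGroup G}.

Section Scale.
Variable G : topologicalGroupType.
Implicit Types (H K U : set G) (alpha : G -> G).

Definition is_subgroup H : Prop := group_closed [in H].

Definition left_cosets H K : set (set G) :=
  [set [set h * k | k in K] | h in H].

(* For a subgroup K of H this is [H : K].  [fset_set] is empty on infinite sets,
   so an infinite index would read as 0; below H is a compact subgroup and K is
   relatively open in H, so that the index is finite. *)
Definition subgroup_index H K : nat := #|` fset_set (left_cosets H K)|.

Definition compact_open_subgroup U : Prop :=
  [/\ is_subgroup U, compact U & open U].

Definition displacement_index alpha U : nat :=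
  subgroup_index (alpha @` U) (alpha @` U `&` U).

(* The default 0 is taken only if no minimum exists, i.e. if [G] has no compact
   open subgroup. *)
Definition scale alpha : nat :=
  xget 0 [set s |
    (exists2 U, compact_open_subgroup U & displacement_index alpha U = s) /\
    (forall U, compact_open_subgroup U -> s <= displacement_index alpha U)%N].

End Scale.

(* Main.v *)
Require Import Defs.
From HB Require Import structures.
From mathcomp Require Import all_boot all_order all_algebra finmap.
From mathcomp Require Import all_classical all_reals all_analysis.
Import numFieldNormedType.Exports.

Local Open Scope classical_set_scope.
Local Open Scope ring_scope.

(* Write [c H K] for the number of left cosets of [K] meeting [H], and [U_{-n}]
   for the set of [x] with [x, f x, ..., f^n x] in [U].  Up to constants,
   [c (f^n V) V] does not depend on [V], and it is submultiplicative in [n];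
   taking [V] minimizing bounds it by [C * s^n].

   Conversely [W_{-n-1}] is the intersection of [X := W_{-n}] and [f^-1 X], so
   each index [W_{-n} : W_{-n-1}] is the displacement index of [X], and
   [s^n <= [W : W_{-n}]] for every compact open subgroup [W].  This index counts
   whole trajectories whereas [c (f^n V) V] only sees their end points, so it
   remains to find [W] for which trajectories between given end points are
   boundedly many modulo [W].  Replacing [V] by a tidy above [U = V_{-m}], one
   has [U = U_+ U_-]; the elements with a full orbit that lies in [U] far in the
   past and far in the future form a relatively compact [f]-stable group [L],
   and a trajectory from [U] to [U] in [n] steps starts in [L U_{-n}].  Any
   compact open [W] containing [L] works: by compactness, such a trajectory lies
   in [W] except for a bounded number of steps at both ends. *)

(** * Finite sets *)

Lemma card_fsetM (T U : choiceType) (A : {fset T}) (B : {fset U}) :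
  #|` (A `*` B)%fset| = (#|` A| * #|` B|)%N.
Proof.
rewrite -(size_allpairs pair A B); apply: perm_size; apply: uniq_perm.
- exact: fset_uniq.
- by apply: allpairs_uniq => //; [exact: fset_uniq..|move=> [? ?] [? ?] _ _ [-> ->]].
- move=> [x y]; rewrite in_fsetM; apply/andP/allpairsP => /=.
    by move=> [xA yB]; exists (x, y).
  by move=> [[x' y'] /= [xA yB [-> ->]]].
Qed.

Lemma finite_set_bound (T : choiceType) (D : set T) (P : T -> nat -> Prop) :
  finite_set D -> (forall c m n, (m <= n)%N -> P c m -> P c n) ->
  (forall c, D c -> exists n, P c n) -> exists N, forall c, D c -> P c N.
Proof.
move=> finD monoP exP.
have [g gP] : {g : T -> nat & forall c, D c -> P c (g c)}.
  apply: (@choice _ _ (fun c n => D c -> P c n)) => c.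
  by have [/exP [n ?]|nDc] := pselect (D c); [exists n | exists 0%N].
exists (\max_(c <- fset_set D) g c) => c Dc; apply: monoP (gP c Dc).
by apply: leq_bigmax_seq => //; rewrite in_fset_set //; exact/mem_set.
Qed.

(** * Indices as numbers of cosets *)

Section CosetCounting.
Set Implicit Arguments.
Unset Strict Implicit.
Local Open Scope group_scope.
Variable G : topologicalGroupType.
Implicit Types (H K L X : set G) (x y : G).

Lemma subgroup1 H : is_subgroup H -> H 1.
Proof. by case=> /set_mem. Qed.

Lemma subgroupM H x y : is_subgroup H -> H x -> H y -> H (x * y).
Proof.
by move=> sH Hx Hy; apply/set_mem/(group_closedM sH); apply/mem_set.
Qed.

Lemma subgroupV H x : is_subgroup H -> H x -> H x^-1.
Proof. by move=> sH Hx; apply/set_mem/(group_closedV sH)/mem_set. Qed.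

Lemma subgroupVM H x y : is_subgroup H -> H x -> H y -> H (x^-1 * y).
Proof. by move=> sH Hx; apply: subgroupM => //; apply: subgroupV. Qed.

Lemma is_subgroupP H : H 1 -> (forall x y, H x -> H y -> H (x * y)) ->
  (forall x, H x -> H x^-1) -> is_subgroup H.
Proof.
move=> H1 HM HV; split; first exact/mem_set.
by move=> x y /set_mem Hx /set_mem Hy; apply/mem_set/HM => //; exact: HV.
Qed.

Lemma is_subgroupI H K : is_subgroup H -> is_subgroup K -> is_subgroup (H `&` K).
Proof.
move=> sH sK; apply: is_subgroupP => [|x y [Hx Kx] [Hy Ky]|x [Hx Kx]].
- by split; apply: subgroup1.
- by split; apply: subgroupM.
- by split; apply: subgroupV.
Qed.

Lemma is_subgroup_preimage (f : G -> G) K : {morph f : x y / x * y} ->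
  is_subgroup K -> is_subgroup (f @^-1` K).
Proof.
move=> fM sK.
have f1 : f 1 = 1 by apply: (mulIg (f 1)); rewrite -fM !mul1g.
have fV x : f x^-1 = (f x)^-1 by apply: (mulIg (f x)); rewrite -fM !mulVg.
apply: is_subgroupP => [|x y Kx Ky|x Kx] /=.
- by rewrite f1; apply: subgroup1.
- by rewrite fM; apply: subgroupM.
- by rewrite fV; apply: subgroupV.
Qed.

Lemma is_subgroup_image (f : G -> G) H : {morph f : x y / x * y} ->
  is_subgroup H -> is_subgroup (f @` H).
Proof.
move=> fM sH.
have f1 : f 1 = 1 by apply: (mulIg (f 1)); rewrite -fM !mul1g.
have fV x : f x^-1 = (f x)^-1 by apply: (mulIg (f x)); rewrite -fM !mulVg.
apply: is_subgroupP => [|_ _ [x Hx <-] [y Hy <-]|_ [x Hx <-]].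
- by exists 1; [apply: subgroup1|].
- by exists (x * y); [apply: subgroupM|].
- by exists x^-1; [apply: subgroupV|].
Qed.

Lemma left_coset_refl K x : is_subgroup K -> [set x * k | k in K] x.
Proof. by move=> sK; exists 1; [apply: subgroup1 | rewrite mulg1]. Qed.

Lemma left_cosetE K x : [set x * k | k in K] = [set y | K (x^-1 * y)].
Proof.
apply/seteqP; split=> y /=; first by case=> k Kk <-; rewrite mulKg.
by move=> Ky; exists (x^-1 * y); rewrite ?mulVKg.
Qed.

Lemma left_coset_eq K x y : is_subgroup K -> K (x^-1 * y) ->
  [set x * k | k in K] = [set y * k | k in K].
Proof.
move=> sK Kxy; rewrite !left_cosetE; apply/seteqP; split=> z /= Kz.
  rewrite (_ : _ * z = (x^-1 * y)^-1 * (x^-1 * z)); first exact: subgroupVM.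
  by rewrite invgM invgK -mulgA mulVKg.
rewrite (_ : _ * z = (x^-1 * y) * (y^-1 * z)); first exact: subgroupM.
by rewrite -mulgA mulVKg.
Qed.

Lemma left_coset_inv K x y : is_subgroup K ->
  [set x * k | k in K] = [set y * k | k in K] -> K (x^-1 * y).
Proof.
move=> sK e; have := @left_coset_refl K y sK.
by rewrite -e left_cosetE.
Qed.

(** Index comparisons below come from maps between sets of cosets. Finiteness is proved along with
    each bound, since an infinite index would read as 0. *)
Lemma card_fset_set_image (T U : choiceType) (f : T -> U) (A : set U) (D : set T) :
  finite_set D -> A `<=` f @` D ->
  finite_set A /\ (#|` fset_set A| <= #|` fset_set D|)%N.
Proof.
move=> finD AfD; have finI := finite_image f finD.
have finA : finite_set A by apply: sub_finite_set finI.
split=> //; apply: (@leq_trans #|` fset_set (f @` D)|).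
  by apply: fsubset_leq_card; rewrite -fset_set_sub.
rewrite fset_set_image //; exact: leq_imfset_card.
Qed.

(** [K] often fails to lie in [H]; for a subgroup [K], [left_cosets H K] consists of the left cosets
    of [K] that meet [H]. *)
Definition finite_index H K := finite_set (left_cosets H K).

Lemma left_cosets_sub H H' K : H `<=` H' -> left_cosets H K `<=` left_cosets H' K.
Proof. by move=> s _ [h Hh <-]; exists h => //; apply: s. Qed.

Lemma subgroup_index_sub H H' K : H `<=` H' -> finite_index H' K ->
  finite_index H K /\ (subgroup_index H K <= subgroup_index H' K)%N.
Proof.
move=> s fin'; apply: (@card_fset_set_image _ _ id) => //.
by rewrite image_id; apply: left_cosets_sub.
Qed.

Lemma subgroup_index_gt0 H K : H !=set0 -> finite_index H K ->
  (0 < subgroup_index H K)%N.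
Proof.
move=> [h Hh] fin; rewrite cardfs_gt0; apply/negP => /eqP e.
have : left_cosets H K [set h * k | k in K] by exists h.
by rewrite (fset_set_set0 fin e).
Qed.

Lemma subgroup_indexxx K : is_subgroup K -> subgroup_index K K = 1%N.
Proof.
move=> sK; suff e : left_cosets K K = [set K].
  by rewrite /subgroup_index e fset_set1 cardfs1.
have hK h : K h -> [set h * k | k in K] = K.
  move=> Kh; rewrite left_cosetE; apply/seteqP; split=> x /= Kx.
    by rewrite -(mulVKg h x); apply: subgroupM.
  exact: subgroupVM.
apply/seteqP; split=> [_ [h Kh <-]|_ ->]; first exact: hK.
by exists 1; [exact: subgroup1 | apply: hK; exact: subgroup1].
Qed.

(** Intersecting with [H] and multiplying by [K] on the right are inverse bijections between the two
    sets of cosets. *)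
Lemma subgroup_index_setI H K : is_subgroup H -> is_subgroup K ->
  finite_index H K ->
  finite_index H (K `&` H) /\ subgroup_index H (K `&` H) = subgroup_index H K.
Proof.
move=> sH sK fin; have sKH := is_subgroupI sK sH.
have [|fin' le1] := @card_fset_set_image _ _ (fun C => C `&` H)
    (left_cosets H (K `&` H)) _ fin.
  move=> _ [h Hh <-]; exists [set h * k | k in K]; first by exists h.
  apply/seteqP; split=> [_ [[k Kk <-] Hhk]|_ [k [Kk Hk] <-]].
    by exists k => //; split=> //; have := subgroupVM sH Hh Hhk; rewrite mulKg.
  by split; [exists k | apply: subgroupM].
split=> //; apply/eqP; rewrite eqn_leq le1 /=.
have [|_ ->//] := @card_fset_set_image _ _
    (fun C => [set c * k | c in C & k in K]) (left_cosets H K) _ fin'.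
move=> _ [h Hh <-]; exists [set h * k | k in K `&` H]; first by exists h.
apply/seteqP; split=> [_ [_ [k [Kk Hk] <-] [k' Kk' <-]]|_ [k Kk <-]].
  by exists (k * k'); [apply: subgroupM | rewrite mulgA].
by exists h; [apply: left_coset_refl | exists k].
Qed.

Lemma subgroup_index_setIl H K : is_subgroup H -> is_subgroup K ->
  finite_index H K -> subgroup_index H (H `&` K) = subgroup_index H K.
Proof. by move=> sH sK fin; rewrite setIC; case: (subgroup_index_setI sH sK fin). Qed.

Lemma subgroup_index_preimage (f : G -> G) H K : {morph f : x y / x * y} ->
  is_subgroup K -> finite_index (f @` H) K ->
  finite_index H (f @^-1` K) /\
  subgroup_index H (f @^-1` K) = subgroup_index (f @` H) K.
Proof.
move=> fM sK fin; have sfK := is_subgroup_preimage fM sK.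
have fE h k : K (f (h^-1 * k)) = K ((f h)^-1 * f k).
  by congr K; apply: (mulgI (f h)); rewrite -fM !mulVKg.
have [|fin' le1] := @card_fset_set_image _ _ (fun C => f @^-1` C)
    (left_cosets H (f @^-1` K)) _ fin.
  move=> _ [h Hh <-]; exists [set f h * k | k in K].
    by exists (f h) => //; exists h.
  by rewrite !left_cosetE; apply/seteqP; split=> y /=; rewrite fE.
split=> //; apply/eqP; rewrite eqn_leq le1 /=.
have [|_ ->//] := @card_fset_set_image _ _
    (fun C => [set f c * k | c in C & k in K]) (left_cosets (f @` H) K) _ fin'.
move=> _ [_ [h Hh <-] <-]; exists [set h * k | k in f @^-1` K]; first by exists h.
apply/seteqP; split=> [_ [_ [k Kk <-] [k' Kk' <-]]|_ [k Kk <-]].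
  by exists (f k * k'); [apply: subgroupM | rewrite fM mulgA].
by exists h; [apply: left_coset_refl | exists k].
Qed.

Lemma subgroup_index_image (f : G -> G) H K : {morph f : x y / x * y} ->
  finite_index H K -> finite_index (f @` H) (f @` K) /\
  (subgroup_index (f @` H) (f @` K) <= subgroup_index H K)%N.
Proof.
move=> fM fin; apply: (card_fset_set_image (f := fun C => f @` C) fin).
move=> _ [_ [h Hh <-] <-]; exists [set h * k | k in K]; first by exists h.
by rewrite !image_comp; congr image; apply/funext => k /=; exact: fM.
Qed.

Lemma subgroup_index_trans H K L : is_subgroup K ->
  finite_index H K -> finite_index K L ->
  finite_index H L /\
  (subgroup_index H L <= subgroup_index H K * subgroup_index K L)%N.
Proof.
move=> sK fin1 fin2.
(* With [r] the representative of [h K] chosen by [xget], [h L] is [r D] for the coset [D] of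
   [r^-1 h], and [r^-1 h] lies in [K]. *)
have [|? le] := @card_fset_set_image _ _
    (fun CD : set G * set G => [set xget 1 CD.1 * d | d in CD.2])
    (left_cosets H L) _ (finite_setX fin1 fin2).
  move=> _ [h Hh <-]; set C := [set h * k | k in K].
  have [k Kk hk] : C (xget 1 C) by apply: xgetPex; exists h; exact: left_coset_refl.
  exists (C, [set k^-1 * l | l in L]).
    by split; [exists h | exists k^-1 => //; exact: subgroupV].
  rewrite /= -hk image_comp; congr image; apply/funext => l /=.
  by rewrite mulgA mulgK.
split=> //; apply: leq_trans le _.
by rewrite fset_setX // card_fsetM.
Qed.

(** A coset [C] of [L] in [H] is sent to the pair of [C K] and [r^-1 C], with [r] chosen in [C K];
    every pair of a coset of [K] in [H] and a coset of [L] in [K] arises. *)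
Lemma subgroup_index_mul_le H K L : is_subgroup H -> is_subgroup K ->
  is_subgroup L -> L `<=` K -> K `<=` H -> finite_index H L ->
  (subgroup_index H K * subgroup_index K L <= subgroup_index H L)%N.
Proof.
move=> sH sK sL LK KH fin.
have finHK : finite_index H K.
  apply: (proj1 (@card_fset_set_image _ _
    (fun C => [set c * k | c in C & k in K]) _ _ fin _)).
  move=> _ [h Hh <-]; exists [set h * l | l in L]; first by exists h.
  apply/seteqP; split=> [_ [_ [l Ll <-] [k Kk <-]]|_ [k Kk <-]].
    by exists (l * k); [apply: subgroupM => //; exact: LK | rewrite mulgA].
  by exists h; [apply: left_coset_refl | exists k].
have finKL : finite_index K L := proj1 (subgroup_index_sub KH fin).
rewrite /subgroup_index -card_fsetM -fset_setX //.
have [|_ //] := @card_fset_set_image _ _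
    (fun C => let C' := [set c * k | c in C & k in K] in
              (C', [set (xget 1 C')^-1 * c | c in C]))
    (left_cosets H K `*` left_cosets K L) _ fin.
move=> [_ _] [/= [h Hh <-] [k Kk <-]]; set C := [set h * k | k in K].
have [k0 Kk0 hk0] : C (xget 1 C) by apply: xgetPex; exists h; exact: left_coset_refl.
exists [set (h * k0 * k) * l | l in L].
  exists (h * k0 * k) => //; apply: subgroupM; [exact: sH| |exact: KH].
  by apply: subgroupM => //; exact: KH.
have -> : [set c * k1 | c in [set h * k0 * k * l | l in L] & k1 in K] = C.
  apply/seteqP; split=> [_ [_ [l Ll <-] [k1 Kk1 <-]]|_ [k1 Kk1 <-]].
    exists (k0 * k * l * k1); last by rewrite !mulgA.
    by rewrite -!mulgA; do 3!(apply: subgroupM => //); exact: LK.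
  exists (h * k0 * k); first exact: left_coset_refl.
  exists (k^-1 * (k0^-1 * k1)); first by do 2!apply: subgroupVM => //.
  by rewrite -!mulgA !mulVKg.
congr pair; rewrite -hk0 image_comp; congr image; apply/funext => l /=.
by rewrite -!(mulgA (h * k0)) mulKg.
Qed.

Lemma subgroup_index_setI_le X K L : finite_index X K -> finite_index X L ->
  finite_index X (K `&` L) /\
  (subgroup_index X (K `&` L) <= subgroup_index X K * subgroup_index X L)%N.
Proof.
move=> fin1 fin2.
have [|? le] := @card_fset_set_image _ _
    (fun CD : set G * set G => CD.1 `&` CD.2)
    (left_cosets X (K `&` L)) _ (finite_setX fin1 fin2).
  move=> _ [h Hh <-]; exists ([set h * k | k in K], [set h * k | k in L]).
    by split; exists h.
  by rewrite !left_cosetE.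
split=> //; apply: leq_trans le _.
by rewrite fset_setX // card_fsetM.
Qed.

End CosetCounting.

(** * Topological groups: separation and finiteness of indices *)

Section TopologicalGroups.
Set Implicit Arguments.
Unset Strict Implicit.
Local Open Scope group_scope.
Variable G : topologicalGroupType.
Implicit Types (H K L X : set G) (x y : G).

Lemma mulg_continuousl x : continuous (fun y => x * y).
Proof.
move=> y; apply: (@cvg_comp _ _ _ (fun y => (x, y)) (fun z : G * G => z.1 * z.2)).
  by apply: (@cvg_pair _ _ _ _ (nbhs x) (nbhs y)); [exact: cvg_cst | exact: cvg_id].
exact: (@mulg_continuous G (x, y)).
Qed.

Lemma mulg_continuousr x : continuous (fun y => y * x).
Proof.
move=> y; apply: (@cvg_comp _ _ _ (fun y => (y, x)) (fun z : G * G => z.1 * z.2)).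
  by apply: (@cvg_pair _ _ _ _ (nbhs y) (nbhs x)); [exact: cvg_id | exact: cvg_cst].
exact: (@mulg_continuous G (y, x)).
Qed.

Lemma divg_continuous : continuous (fun z : G * G => z.1^-1 * z.2).
Proof.
move=> [x y].
apply: (@cvg_comp _ _ _ (fun z : G * G => (z.1^-1, z.2))
                        (fun z : G * G => z.1 * z.2)); last first.
  exact: (@mulg_continuous G (x^-1, y)).
apply: (@cvg_pair _ _ _ _ (nbhs x^-1) (nbhs y)); last exact: cvg_snd.
apply: (@cvg_comp _ _ _ fst (fun z : G => z^-1)); first exact: cvg_fst.
exact: (@invg_continuous G x).
Qed.

(** If [x] and [y] differ, [x^-1 * y] is not 1, hence neither is any [a^-1 * b] with [a] near [x]
    and [b] near [y], so these neighbourhoods are disjoint. *)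
Lemma accessible_group_hausdorff : closed [set (1 : G)] -> hausdorff_space G.
Proof.
move=> cl1 x y clxy; apply/eqP/negPn/negP => /eqP nxy.
have : nbhs (x^-1 * y) (~` [set (1 : G)]).
  apply: open_nbhs_nbhs; split; first exact: closed_openC.
  by move=> /= e; apply: nxy; rewrite -(mulg1 x) -e mulVKg.
move/(@divg_continuous (x, y)) => [[A B] [/= nA nB] AB].
have [z [Az Bz]] := clxy _ _ nA nB.
by apply: (AB (z, z)) => //=; rewrite mulVg.
Qed.

Lemma totally_disconnected_hausdorff :
  totally_disconnected [set: G] -> hausdorff_space G.
Proof.
move=> td; apply: accessible_group_hausdorff; rewrite -(td 1) //.
exact/component_closed/closedT.
Qed.

Lemma open_left_coset K x : open K -> open [set x * k | k in K].
Proof.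
move=> oK; rewrite left_cosetE.
have /continuousP cm := @mulg_continuousl x^-1; exact: cm.
Qed.

Lemma open_subgroup_closed K : is_subgroup K -> open K -> closed K.
Proof.
move=> sK oK; rewrite -openC.
have -> : ~` K = \bigcup_(x in ~` K) [set x * k | k in K].
  apply/seteqP; split=> [x nKx|_ [x nKx [k Kk <-]] Kxk].
    by exists x => //; exact: left_coset_refl.
  by apply: nKx; rewrite -(mulgK k x); apply: subgroupM => //; apply: subgroupV.
by apply: bigcup_open => x _; exact: open_left_coset.
Qed.

Lemma subgroup_nbhs_open K : is_subgroup K -> nbhs 1 K -> open K.
Proof.
move=> sK nK; rewrite openE => x Kx.
have nxK : nbhs (x^-1 * x) K by rewrite mulVg.
apply: (@filterS _ (nbhs x) _ _ K _ (@mulg_continuousl x^-1 x K nxK)) => y /= Kxy.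
by rewrite -(mulVKg x y); apply: subgroupM.
Qed.

Lemma compact_finite_index H K : compact H -> is_subgroup K -> open K ->
  finite_index H K.
Proof.
move=> /compact_near_coveringP cH sK oK.
(* Along [F], a variable set [D] of cosets eventually contains any given finite set. Points near [x]
   share its coset, so compactness yields a single finite set of cosets valid on all of [H]. *)
pose F := filter_from [set D : set (set G) | finite_set D]
                      (fun D0 => [set D | D0 `<=` D]).
have FF : Filter F.
  apply: filter_from_filter; first by exists set0; exact: finite_set0.
  move=> D1 D2 fin1 fin2; exists (D1 `|` D2); first by rewrite /= finite_setU.
  by move=> D /= sD; split=> C DC; apply: sD; [left|right].
have [|D0 finD0 D0H] := cH _ F (fun D x => D [set x * k | k in K]) FF.
  move=> x Hx; exists ([set x * k | k in K], [set D | D [set x * k | k in K]]).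
    split => /=.
      apply: open_nbhs_nbhs; split; first exact: open_left_coset.
      exact: left_coset_refl.
    exists [set [set x * k | k in K]]; first exact: finite_set1.
    by move=> D; apply.
  move=> [y D] [/= [k Kk <-] Dx]; rewrite -(left_coset_eq sK (x := x)) //.
  by rewrite mulKg.
apply: sub_finite_set finD0 => _ [h Hh <-].
by apply: (D0H D0).
Qed.

Lemma compact_setM H K : compact H -> compact K ->
  compact [set h * k | h in H & k in K].
Proof.
move=> cH cK.
have -> : [set h * k | h in H & k in K] =
          (fun z : G * G => z.1 * z.2) @` (H `*` K).
  apply/seteqP; split=> [_ [h Hh [k Kk <-]]|_ [[h k] [/= Hh Kk] <-]].
    by exists (h, k).
  by exists h => //; exists k.
apply: continuous_compact; last exact: compact_setX.
exact/continuous_subspaceT/mulg_continuous.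
Qed.

End TopologicalGroups.

(** * Nested closed sets in a compact set *)

Lemma compact_decreasing_empty (T : topologicalType) (A : set T)
    (F : nat -> set T) : compact A -> (forall n, closed (F n)) ->
  (forall n, F n.+1 `<=` F n) -> (forall x, A x -> exists n, ~ F n x) ->
  exists n, A `&` F n = set0.
Proof.
move=> /compact_near_coveringP cA clF decF AF.
have Fle m n : (m <= n)%N -> F n `<=` F m.
  move=> /subnK <-; elim: (n - m)%N => // k IH x; rewrite addSn => /decF; exact: IH.
have [|N _ NF] := cA _ \oo (fun n x => ~ F n x) _.
  move=> x /AF[n nFx]; exists (~` F n, [set m | (n <= m)%N]).
    split; last by exists n.
    by apply: open_nbhs_nbhs; split=> //; exact/closed_openC.
  by move=> [y m] [/= nFy le_nm] /(Fle _ _ le_nm).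
exists N; apply/seteqP; split=> // x [Ax Fx]; exact: (NF N (leqnn N) x Ax Fx).
Qed.

Lemma compact_decreasing_nonempty (T : topologicalType) (A : set T)
    (F : nat -> set T) : compact A -> (forall n, closed (F n)) ->
  (forall n, F n.+1 `<=` F n) -> (forall n, A `&` F n !=set0) ->
  exists2 x, A x & forall n, F n x.
Proof.
move=> cA clF decF AF; apply: contrapT => no.
have [|n e] := compact_decreasing_empty cA clF decF; last first.
  by have [x] := AF n; rewrite e.
move=> x Ax; apply: contrapT => nex; apply: no; exists x => // n.
by apply: contrapT => nF; apply: nex; exists n.
Qed.

(** * Trajectories of an endomorphism *)

Section Trajectories.
Set Implicit Arguments.
Unset Strict Implicit.
Local Open Scope group_scope.
Variables (G : topologicalGroupType) (f : G -> G).
Hypotheses (fM : {morph f : x y / x * y}) (hG : hausdorff_space G)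
  (f_cont : continuous f).
Implicit Types (H K L U V W X : set G) (x y : G).

Lemma iter_mulgM n : {morph iter n f : x y / x * y}.
Proof. by elim: n => // n IH x y; rewrite !iterS IH fM. Qed.

Lemma iter_mulg1 n : iter n f 1 = 1.
Proof. by apply: (mulIg (iter n f 1)); rewrite -iter_mulgM !mul1g. Qed.

Lemma iter_mulgV n x : iter n f x^-1 = (iter n f x)^-1.
Proof. by apply: (mulIg (iter n f x)); rewrite -iter_mulgM !mulVg iter_mulg1. Qed.

Let fV x : f x^-1 = (f x)^-1.
Proof. exact: (iter_mulgV 1). Qed.

Lemma iter_mulgVM n x y : iter n f (x^-1 * y) = (iter n f x)^-1 * iter n f y.
Proof. by rewrite iter_mulgM iter_mulgV. Qed.

Lemma iter_continuous n : continuous (iter n f).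
Proof.
elim: n => [|n IH] x; first exact: cvg_id.
change (continuous_at x (f \o iter n f)).
by apply: continuous_comp; [exact: IH | exact: f_cont].
Qed.

Lemma iter_image_compact n H : compact H -> compact (iter n f @` H).
Proof.
by move=> cH; apply: continuous_compact cH; exact/continuous_subspaceT/iter_continuous.
Qed.

(* The subgroups [U_{-n}], [U_n = f^n (U_{-n})], [U_-] and [U_+] of the
   literature are [staying U n], [arriving U n], [forward U] and [backward U]. *)
Definition staying U n : set G := [set x | forall k, (k <= n)%N -> U (iter k f x)].
Definition arriving U n : set G := iter n f @` staying U n.
Definition forward U : set G := [set x | forall k, U (iter k f x)].
Definition backward U : set G := [set x | forall n, arriving U n x].

Lemma staying0 U : staying U 0 = U.
Proof.
apply/seteqP; split=> x; first by move=> /(_ 0%N); exact.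
by move=> Ux k; rewrite leqn0 => /eqP ->.
Qed.

Lemma stayingS U n : staying U n.+1 = staying U n `&` iter n.+1 f @^-1` U.
Proof.
apply/seteqP; split=> x.
  by move=> sx; split=> [k kn|]; apply: sx => //; exact: leqW.
by move=> [sx Ux] k; rewrite leq_eqVlt => /orP[/eqP ->//|]; exact: sx.
Qed.

Lemma staying_le U m n : (m <= n)%N -> staying U n `<=` staying U m.
Proof. by move=> mn x sx k km; apply: sx; exact: leq_trans mn. Qed.

Lemma staying_iter U m n x : staying U (m + n) x -> staying U n (iter m f x).
Proof. by move=> sx k kn; rewrite -iterD; apply: sx; rewrite addnC leq_add2l. Qed.

Lemma staying_add U m n :
  staying U (m + n) = staying U m `&` iter m f @^-1` staying U n.
Proof.
apply/seteqP; split=> x.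
  by move=> sx; split; [exact: staying_le (leq_addr _ _) _ sx | exact: staying_iter].
move=> [sm sn] k; have [/sm //|lt_mk] := leqP k m.
by rewrite -leq_subLR => /sn; rewrite -iterD subnK // ltnW.
Qed.

Lemma staying_sub U n : staying U n `<=` U.
Proof. by move=> x /(_ 0%N); exact. Qed.

Lemma staying_subgroup U n : is_subgroup U -> is_subgroup (staying U n).
Proof.
move=> sU; elim: n => [|n IH]; first by rewrite staying0.
rewrite stayingS; apply: is_subgroupI => //.
exact: is_subgroup_preimage (iter_mulgM _) _.
Qed.

Lemma staying_closed U n : closed U -> closed (staying U n).
Proof.
move=> cU; elim: n => [|n IH]; first by rewrite staying0.
rewrite stayingS; apply: closedI => //.
have /continuous_closedP ci := @iter_continuous n.+1; exact: ci.
Qed.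

Lemma staying_open U n : open U -> open (staying U n).
Proof.
move=> oU; elim: n => [|n IH]; first by rewrite staying0.
rewrite stayingS; apply: openI => //.
have /continuousP ci := @iter_continuous n.+1; exact: ci.
Qed.

Lemma compact_open_closed U : compact_open_subgroup U -> closed U.
Proof. by case=> sU _; exact: open_subgroup_closed. Qed.

Lemma staying_compact_open U n :
  compact_open_subgroup U -> compact_open_subgroup (staying U n).
Proof.
move=> coU; have [sU cU oU] := coU; split; first exact: staying_subgroup.
  apply: (subclosed_compact _ cU (@staying_sub U n)).
  by apply: staying_closed; exact: compact_open_closed.
exact: staying_open.
Qed.

Lemma arriving_subgroup U n : is_subgroup U -> is_subgroup (arriving U n).
Proof.
by move=> sU; apply: is_subgroup_image (iter_mulgM _) _; exact: staying_subgroup.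
Qed.

Lemma arriving_closed U n : compact_open_subgroup U -> closed (arriving U n).
Proof.
move=> coU; apply: (compact_closed hG); apply: iter_image_compact.
by have [] := staying_compact_open n coU.
Qed.

Lemma arrivingS U n : arriving U n.+1 `<=` arriving U n.
Proof.
move=> _ [x sx <-]; exists (f x); last by rewrite iterSr.
exact: (@staying_iter U 1).
Qed.

Lemma arriving_le U m n : (m <= n)%N -> arriving U n `<=` arriving U m.
Proof.
move=> /subnK <-; elim: (n - m)%N => // k IH x; rewrite addSn => /arrivingS; exact: IH.
Qed.

Lemma forward_subgroup U : is_subgroup U -> is_subgroup (forward U).
Proof.
move=> sU; apply: is_subgroupP => [|x y Ux Uy|x Ux] k.
- by rewrite iter_mulg1; apply: subgroup1.
- by rewrite iter_mulgM; apply: subgroupM.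
- by rewrite iter_mulgV; apply: subgroupV.
Qed.

Lemma forward_staying U x : (forall n, staying U n x) -> forward U x.
Proof. by move=> sx k; apply: (sx k). Qed.

Lemma backward_subgroup U : is_subgroup U -> is_subgroup (backward U).
Proof.
move=> sU; apply: is_subgroupP => [|x y Ux Uy|x Ux] n.
- exact: (subgroup1 (arriving_subgroup n sU)).
- exact: (subgroupM (arriving_subgroup n sU)).
- exact: (subgroupV (arriving_subgroup n sU)).
Qed.

Lemma backward_sub U : backward U `<=` U.
Proof. by move=> x /(_ 0%N) [y /staying_sub Uy <-]. Qed.

(** Trajectories of [n+1] steps in [U] ending at [x] give, one step earlier, points of
    [arriving U n] over [x]; compactness yields one that works for all [n]. *)
Lemma backward_pred U x : compact_open_subgroup U -> backward U x ->
  exists2 y, backward U y & f y = x.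
Proof.
move=> coU bx; have [_ cU _] := coU.
have [|n|n|y Uy Fy] := @compact_decreasing_nonempty G U
    (fun n => arriving U n `&` f @^-1` [set x]) cU.
- move=> n; apply: closedI; first exact: arriving_closed.
  have /continuous_closedP cf := f_cont; apply: cf.
  by apply: accessible_closed_set1; exact: hausdorff_accessible.
- by move=> y [/arrivingS].
- have [z sz zx] := bx n.+1; exists (iter n f z); split; first exact: sz.
  by split=> //; exists z => //; exact: staying_le sz.
- by exists y; [move=> n; have [] := Fy n | have [] := Fy 0%N].
Qed.

Lemma backward_lift U n x : compact_open_subgroup U -> backward U x ->
  exists y, [/\ backward U y, staying U n y & iter n f y = x].
Proof.
move=> coU; elim: n x => [|n IH] x bx.
  by exists x; split=> //; rewrite staying0; exact: backward_sub.
have [y by_ yx] := backward_pred coU bx.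
have [z [bz sz zy]] := IH _ by_; exists z; split=> //=; last by rewrite zy.
by rewrite stayingS; split=> //=; rewrite zy yx; exact: backward_sub.
Qed.

(* Equivalent to [f U `<=` f (backward U) * U], i.e. to [U] being tidy above. *)
Definition tidy_above U := forall n x, U x ->
  exists2 z, staying U n z & U ((iter n.+1 f z)^-1 * f x).

(* The finite sets of cosets [f^(n+1) (U_{-n}) U / U] decrease with [n]; once
   they are constant, [U_{-n}] is tidy above. *)
Lemma tidy_above_staying U : compact_open_subgroup U ->
  exists m, tidy_above (staying U m).
Proof.
move=> coU; have [sU cU oU] := coU.
pose H n := iter n.+1 f @` staying U n.
have finH n : finite_index (H n) U.
  apply: compact_finite_index => //; apply: iter_image_compact.
  by have [] := staying_compact_open n coU.
have HS m n : H (m + n)%N `<=` H m.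
  rewrite addnC; elim: n => // n IH x; rewrite addSn => -[z sz <-]; apply: IH.
  exists (f z); first exact: (@staying_iter U 1).
  by rewrite -iterSr.
pose P v := `[< exists m, subgroup_index (H m) U = v >].
have exP : exists v, P v by exists (subgroup_index (H 0%N) U); apply/asboolP; exists 0%N.
have [v /asboolP [m Hm] min_v] := ex_minnP exP.
exists m => n x sx; have sx' : H m (iter m.+1 f x) by exists x.
have : left_cosets (H m) U = left_cosets (H (m + n)%N) U.
  apply: (fset_set_inj (finH m) (finH (m + n)%N)); apply/eqP.
  rewrite eq_sym eqEfcard; apply/andP; split.
    by rewrite -fset_set_sub; [apply: left_cosets_sub; exact: HS|exact: finH..].
  rewrite -/(subgroup_index _ _) Hm; apply: min_v.
  by apply/asboolP; exists (m + n)%N.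
have /[swap] -> : left_cosets (H m) U [set iter m.+1 f x * u | u in U].
  by exists (iter m.+1 f x).
move=> [_ [z sz <-] /(left_coset_inv sU) Uzx]; exists z.
  by move=> i le_in j le_jm; rewrite -iterD; apply: sz; exact: leq_add.
(* For [k = m] this is the equality of cosets just obtained; for [k < m] both factors lie in [U]. *)
move=> k; rewrite iter_mulgVM -iterSr -iterD.
rewrite leq_eqVlt => /orP[/eqP -> |lt_km]; first by rewrite addnS.
apply: subgroupVM => //; last exact: sx.
by apply: sz; rewrite addnS -addSn leq_add2r.
Qed.

(** * Factorisation of a tidy above subgroup and its returning trajectories *)

Section TidyAbove.
Variable U : set G.
Hypotheses (coU : compact_open_subgroup U) (tidyU : tidy_above U).

Let sU : is_subgroup U. Proof. by case: coU. Qed.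
Let cU : compact U. Proof. by case: coU. Qed.
Let oU : open U. Proof. by case: coU. Qed.
Let clU : closed U. Proof. exact: compact_open_closed. Qed.

Lemma tidy_above_backward x : U x ->
  exists2 p, backward U p & U ((f p)^-1 * f x).
Proof.
move=> Ux.
have [|n|n|p Up Fp] := @compact_decreasing_nonempty G U
    (fun n => arriving U n `&` [set y | U ((f y)^-1 * f x)]) cU.
- move=> n; apply: closedI; first exact: arriving_closed.
  have cc : continuous (fun y => (f y)^-1 * f x).
    move=> y; apply: (@continuous_comp _ _ _ (fun y => (f y)^-1) (fun z => z * f x));
      last exact: mulg_continuousr.
    by apply: continuous_comp; [exact: f_cont | exact: invg_continuous].
  by move/continuous_closedP: cc; apply; exact: clU.
- by move=> y [/arrivingS].
- have [z sz Uz] := tidyU n Ux; exists (iter n f z); split; first exact: sz.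
  by split=> //; exists z.
- by exists p; [move=> n; have [] := Fp n | have [] := Fp 0%N].
Qed.

(** If [y = p^-1 * x] stays for [n] steps, [f^(n+1) y] lies in [f q * U] for some [q] in [U_+].
    Lifting [q] back by [n] steps to [v], the element [v^-1 * y] stays one step longer. *)
Lemma backward_staying n x : U x ->
  exists2 p, backward U p & staying U n (p^-1 * x).
Proof.
move=> Ux; elim: n => [|n [p bp sp]].
  exists 1; first exact: (subgroup1 (backward_subgroup sU)).
  by rewrite staying0 invg1 mul1g.
have [q bq Uq] := tidy_above_backward (sp n (leqnn n)).
have [v [bv sv vq]] := backward_lift n coU bq.
exists (p * v); first exact: (subgroupM (backward_subgroup sU)).
rewrite invgM -mulgA stayingS; split.
  exact: (subgroupVM (staying_subgroup n sU)).
by rewrite /= iter_mulgVM vq fM fV.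
Qed.

(** The factorisation [U = U_+ U_-], obtained from [backward_staying] by compactness as [n]
    grows. *)
Lemma backward_forward x : U x -> exists2 p, backward U p & forward U (p^-1 * x).
Proof.
move=> Ux.
have [|n|n|p Up Fp] := @compact_decreasing_nonempty G U
    (fun n => arriving U n `&` [set p | staying U n (p^-1 * x)]) cU.
- move=> n; apply: closedI; first exact: arriving_closed.
  have cc : continuous (fun p => p^-1 * x).
    move=> y; apply: (@continuous_comp _ _ _ (fun y => y^-1) (fun z => z * x)).
      exact: invg_continuous.
    exact: mulg_continuousr.
  by move/continuous_closedP: cc; apply; exact: staying_closed.
- by move=> p [/arrivingS ? /= sp]; split=> //; exact: (staying_le (leqnSn n) sp).
- have [p bp sp] := backward_staying n Ux; exists p; split=> //.
  exact: backward_sub.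
- exists p; first by move=> n; have [] := Fp n.
  by apply: forward_staying => n; have [] := Fp n.
Qed.

Lemma forward_backward x : U x -> exists2 p, backward U p & forward U (x * p^-1).
Proof.
move=> Ux; have [p bp fp] := backward_forward (subgroupV sU Ux).
exists p^-1; first exact: (subgroupV (backward_subgroup sU)).
by rewrite -(invgK x) -invgM; exact: (subgroupV (forward_subgroup sU)).
Qed.

(** Write [f^n x = a * p] with [a] in [U_-] and [p] in [U_+], and lift [p] to [v] staying in [U] for
    [n] steps. Then [r = x * v^-1] has [f^n r = a], and [(f r)^-1 * f x = f v]. *)
Lemma return_correction n x : U x -> (0 < n)%N -> U (iter n f x) ->
  exists r, [/\ U r, U ((f r)^-1 * f x) & forward U (iter n f r)].
Proof.
move=> Ux n_gt0 Unx; have [p bp fp] := forward_backward Unx.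
have [v [bv sv vp]] := backward_lift n coU bp.
exists (x * v^-1); split.
- by apply: subgroupM => //; apply: subgroupV => //; exact: backward_sub.
- by rewrite fM fV invgM invgK mulgVK; exact: (sv 1%N).
- by rewrite iter_mulgM iter_mulgV vp.
Qed.

(** [f U] meets finitely many cosets of [U]. For each of them take the least return time [n0] of a
    point whose image lies in it: the correction of that point serves every other such point, and
    stays in [U] from time [n0] on. [N] bounds these times. *)
Lemma uniform_return_correction : exists N, forall n x,
  U x -> (0 < n)%N -> U (iter n f x) ->
  exists r, [/\ U r, U ((f r)^-1 * f x) &
    forall k, (n <= k)%N || (N <= k)%N -> U (iter k f r)].
Proof.
have finfU : finite_index (f @` U) U.
  by apply: compact_finite_index => //; exact: (@iter_image_compact 1).
have [||N NP] := @finite_set_bound _ _ (fun (c : set G) N => forall n x,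
  c (f x) -> U x -> (0 < n)%N -> U (iter n f x) ->
  exists r, [/\ U r, U ((f r)^-1 * f x) &
    forall k, (n <= k)%N || (N <= k)%N -> U (iter k f r)]) finfU.
- move=> c m n le_mn Pm i x cx Ux i_gt0 Uix.
  have [r [Ur Urx rk]] := Pm i x cx Ux i_gt0 Uix; exists r; split=> // k.
  by move=> /orP[ik|nk]; apply: rk; rewrite ?ik // (leq_trans le_mn nk) orbT.
- move=> _ [_ [g Ug <-] <-]; rewrite left_cosetE.
  pose Q n := `[< exists x, [/\ U ((f g)^-1 * f x), U x, (0 < n)%N & U (iter n f x)] >].
  have [exQ|nQ] := pselect (exists n, Q n); last first.
    exists 0%N => n x gx Ux n0 Unx; case: nQ; exists n.
    by apply/asboolP; exists x.
  have [n0 /asboolP [x0 [gx0 Ux0 n0_gt0 Un0]] min_n0] := ex_minnP exQ.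
  have [r [Ur Urx0 fr]] := return_correction Ux0 n0_gt0 Un0.
  exists n0 => n x gx Ux n_gt0 Unx; exists r; split=> //.
    rewrite (_ : _ * _ = ((f r)^-1 * f x0) * (((f g)^-1 * f x0)^-1 * ((f g)^-1 * f x))).
      by apply: subgroupM => //; exact: subgroupVM.
    by rewrite invgM invgK -!mulgA !mulVKg.
  move=> k; have le_n0n : (n0 <= n)%N by apply: min_n0; apply/asboolP; exists x.
  have [le_n0k _|lt_kn0 /orP[|//]] := leqP n0 k.
    by rewrite -(subnK le_n0k) iterD; exact: fr.
  by move=> le_nk; have := leq_trans le_n0n le_nk; rewrite leqNgt lt_kn0.
exists N => n x Ux; apply: (NP [set f x * u | u in U]) => //.
  by exists (f x) => //; exists x.
exact: left_coset_refl.
Qed.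

(** This is the product [f^k(U) ... f(U) U]. *)
Fixpoint image_product k : set G := if k is k'.+1
  then [set a * b | a in iter k f @` U & b in image_product k'] else U.

Lemma image_product_compact k : compact (image_product k).
Proof.
by elim: k => //= k IH; apply: compact_setM => //; exact: (@iter_image_compact k.+1).
Qed.

Lemma image_product_le m n : (m <= n)%N -> image_product m `<=` image_product n.
Proof.
move=> /subnK <-; elim: (n - m)%N => // k IH x Zx; rewrite addSn /=.
exists 1; last by exists x; [exact: IH | rewrite mul1g].
by exists 1; [exact: subgroup1 | rewrite -iterS iter_mulg1].
Qed.

(** Correcting the first step by [r] writes [f^(k+1) x] as [f^(k+1) r * f^k y], where [y] returns to
    [U] in one step less. Iterating, the factors with exponents above [N] lie in [U], and the
    product of the others in [image_product N]. *)
Lemma returning_trajectory_compact : exists2 K, compact K &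
  forall n k x, (k <= n)%N -> U x -> U (iter n f x) -> K (iter k f x).
Proof.
have [N NP] := uniform_return_correction.
exists [set a * b | a in U & b in image_product N].
  by apply: compact_setM => //; exact: image_product_compact.
have step n k x : (k < n)%N -> U x -> U (iter n f x) -> exists r y,
    [/\ U r, U y /\ U (iter n.-1 f y), (N <= k)%N -> U (iter k.+1 f r) &
        iter k.+1 f x = iter k.+1 f r * iter k f y].
  case: n => // n; rewrite ltnS => lt_kn Ux Unx.
  have [r [Ur Uy rk]] := NP _ _ Ux (ltn0Sn n) Unx.
  exists r, ((f r)^-1 * f x); split=> //.
  - split=> //; rewrite [n.+1.-1]/= iter_mulgVM -!iterSr.
    by apply: subgroupVM => //; apply: rk; rewrite leqnn.
  - by move=> le_Nk; apply: rk; rewrite (leqW le_Nk) orbT.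
  - by rewrite !iterSr -iter_mulgM mulVKg.
have early n k x : (k <= n)%N -> U x -> U (iter n f x) -> image_product k (iter k f x).
  elim: k n x => // k IH [//|n] x lt_kn Ux Unx.
  have [r [y [Ur [Uy Uny] _ ->]]] := step _ _ _ lt_kn Ux Unx.
  exists (iter k.+1 f r); first by exists r.
  by exists (iter k f y) => //; exact: IH Uny.
move=> n k; elim: k n => [|k IH] n x le_kn Ux Unx.
  exists 1; first exact: subgroup1.
  exists x; last by rewrite mul1g.
  exact: (image_product_le (leq0n N)).
have [le_kN|lt_Nk] := leqP k.+1 N.
  exists 1; first exact: subgroup1.
  exists (iter k.+1 f x); last by rewrite mul1g.
  by apply: (image_product_le le_kN); exact: (early n).
have [r [y [Ur [Uy Uny] Ukr ->]]] := step _ _ _ le_kn Ux Unx.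
case: n le_kn Unx Uny => // n le_kn Unx Uny.
have [a Ua [b Zb <-]] := IH n y le_kn Uy Uny.
exists (iter k.+1 f r * a); first exact: (subgroupM sU (Ukr _)).
by exists b => //; rewrite mulgA.
Qed.

(* Willis' [\mathcal{L}_U = U_{++} \cap U_{--}]. *)
Definition homoclinic : set G := [set x |
  (exists m, exists2 u, backward U u & iter m f u = x) /\
  (exists M, forall k, (M <= k)%N -> U (iter k f x))].

Lemma homoclinic_subgroup : is_subgroup homoclinic.
Proof.
apply: is_subgroupP.
- split; last by exists 0%N => k _; rewrite iter_mulg1; exact: subgroup1.
  exists 0%N, 1 => //; exact: (subgroup1 (backward_subgroup sU)).
- move=> _ _ [[m [u bu <-]] [M MP]] [[m' [u' bu' <-]] [M' MP']]; split; last first.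
    exists (maxn M M') => k; rewrite geq_max iter_mulgM => /andP[? ?].
    by apply: subgroupM; [|exact: MP|exact: MP'].
  (* Lifting by [m'] and by [m] steps makes both factors images under [f^(m + m')]. *)
  have [v [bv _ vu]] := backward_lift m' coU bu.
  have [v' [bv' _ vu']] := backward_lift m coU bu'.
  exists (m + m')%N, (v * v').
    exact: (subgroupM (backward_subgroup sU)).
  by rewrite iter_mulgM iterD vu addnC iterD vu'.
- move=> _ [[m [u bu <-]] [M MP]]; split; last first.
    by exists M => k /MP; rewrite iter_mulgV; exact: subgroupV.
  exists m, u^-1; last by rewrite iter_mulgV.
  exact: (subgroupV (backward_subgroup sU)).
Qed.

Lemma homoclinic_iter n x : homoclinic x -> homoclinic (iter n f x).
Proof.
move=> [[m [u bu <-]] [M MP]]; split; first by exists (n + m)%N, u; rewrite ?iterD.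
by exists M => k le_Mk; rewrite -iterD; apply: MP; rewrite (leq_trans le_Mk) ?leq_addr.
Qed.

(** A point [f^m u] of [homoclinic] lies on a trajectory that starts at [u] in [U] and is back in
    [U] at time [M + m]. *)
Lemma homoclinic_compact : exists2 K, compact K & homoclinic `<=` K.
Proof.
have [K cK KP] := returning_trajectory_compact; exists K => //.
move=> _ [[m [u bu <-]] [M MP]]; apply: (KP (M + m)%N); first exact: leq_addl.
  exact: backward_sub.
by rewrite iterD; apply: MP.
Qed.

Lemma backward_forward_homoclinic x : backward U x -> forward U x -> homoclinic x.
Proof. by move=> bx fx; split; [exists 0%N, x | exists 0%N => k _]. Qed.

(** Write [x = p * q] with [p] in [U_+] and [q] in [U_-]. Then [f^n p] is in [U]; lift its [U_+]
    factor to [v]. The image of [l = p * v^-1] under [f^n] is in [U_-], so [l] is homoclinic, and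
    [l^-1 * x = v * q] stays in [U] for [n] steps. *)
Lemma returning_homoclinic n x : U x -> U (iter n f x) ->
  exists2 l, homoclinic l & staying U n (l^-1 * x).
Proof.
move=> Ux Unx; have [p bp fq] := backward_forward Ux.
have Unp : U (iter n f p).
  rewrite -(invgK p) -(mulgK x p^-1) invgM invgK iter_mulgM iter_mulgV.
  by apply: subgroupM => //; apply: subgroupV.
have [q' bq' fq'] := forward_backward Unp.
have [v [bv sv vq]] := backward_lift n coU bq'.
exists (p * v^-1).
  split.
    exists 0%N, (p * v^-1) => //; have sb := backward_subgroup sU.
    exact: (subgroupM sb bp (subgroupV sb bv)).
  exists n => k /subnK <-; rewrite iterD iter_mulgM iter_mulgV vq; exact: fq'.
rewrite invgM invgK -mulgA; apply: (subgroupM (staying_subgroup n sU) sv).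
by move=> k _; exact: fq.
Qed.

End TidyAbove.

End Trajectories.

(** * Compact open subgroups containing a relatively compact subgroup *)

Section CompactOpenHull.
Set Implicit Arguments.
Unset Strict Implicit.
Local Open Scope group_scope.
Variable G : topologicalGroupType.

(* The stabiliser of the compact open set [L U] under left translation. *)
Lemma compact_open_hull (L K U : set G) : hausdorff_space G ->
  is_subgroup L -> compact K -> L `<=` K -> compact_open_subgroup U ->
  exists2 W, compact_open_subgroup W & L `<=` W.
Proof.
move=> hG sL cK LK [sU cU oU].
pose S := \bigcup_(l in L) [set l * u | u in U].
have oS : open S by apply: bigcup_open => l _; exact: open_left_coset.
have SU x y : S x -> U (x^-1 * y) -> S y.
  move=> [l Ll [u Uu <-]] Uxy; exists l => //; exists (u * ((l * u)^-1 * y)).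
    exact: subgroupM.
  by rewrite mulgA mulVKg.
have clS : closed S.
  rewrite -openC (_ : ~` S = \bigcup_(x in ~` S) [set x * u | u in U]).
    by apply: bigcup_open => x _; exact: open_left_coset.
  apply/seteqP; split=> [x nSx|_ [x nSx [u Uu <-]] Sxu].
    by exists x => //; exact: left_coset_refl.
  apply: nSx; apply: SU Sxu _; rewrite invgM mulgVK; exact: subgroupV.
have cS : compact S.
  apply: (subclosed_compact clS (compact_setM cK cU)) => _ [l Ll [u Uu <-]].
  by exists l; [exact: LK | exists u].
have S1 : S 1 by exists 1; [exact: subgroup1 | exact: left_coset_refl].
have LS l x : L l -> S x -> S (l * x).
  move=> Ll [l' Ll' [u Uu <-]]; exists (l * l'); first exact: subgroupM.
  by exists u; rewrite ?mulgA.
(* The two conditions say that [x^-1 S] and [x S] lie in [S], which makes [W] closed under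
   inversion. *)
pose W := [set x | forall y, S y -> S (x^-1 * y) /\ S (x * y)].
have sW : is_subgroup W.
  apply: is_subgroupP => [y Sy|x x' Wx Wx' y Sy|x Wx y Sy].
  - by rewrite invg1 !mul1g.
  - split; first by rewrite invgM -mulgA; apply/(Wx' _ _).1/(Wx _ _).1.
    by rewrite -mulgA; apply/(Wx _ _).2/(Wx' _ _).2.
  - by rewrite invgK; split; apply Wx.
(* [S] is open, so each [y] in [S] has a neighbourhood carried into [S] by all [x^-1] with [x] near
   1; as [S] is compact, one neighbourhood of 1 serves all of [S]. *)
have nO : nbhs 1 [set x : G | forall y, S y -> S (x^-1 * y)].
  move/compact_near_coveringP: cS => /(_ _ (nbhs 1) (fun x y => S (x^-1 * y)) _).
  apply => y Sy.
  have nSy : nbhs ((1 : G)^-1 * y) S by rewrite invg1 mul1g; exact: open_nbhs_nbhs.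
  have [[A B] [/= nA nB] AB] := @divg_continuous G (1, y) S nSy.
  by exists (B, A) => // -[b a] [/= Bb Aa]; exact: (AB (a, b)).
have nW : nbhs 1 W.
  have nV : nbhs (1 : G)^-1 [set x : G | forall y, S y -> S (x^-1 * y)].
    by rewrite invg1.
  have nO' := @invg_continuous G 1 _ nV.
  apply: filterS (filterI nO nO') => x [/= Sx Sx'] y Sy; split; first exact: Sx.
  by have := Sx' y Sy; rewrite invgK.
have oW := subgroup_nbhs_open sW nW.
exists W; first split=> //.
  apply: (subclosed_compact (open_subgroup_closed sW oW) cS) => x Wx.
  by rewrite -(mulg1 x); apply (Wx 1).
by move=> l Ll y Sy; split; apply: LS => //; exact: subgroupV.
Qed.

End CompactOpenHull.

(** * Counting trajectories: the scale against the growth of indices *)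

Section TrajectoryCounting.
Set Implicit Arguments.
Unset Strict Implicit.
Local Open Scope group_scope.
Variables (G : topologicalGroupType) (f : G -> G).
Hypotheses (fM : {morph f : x y / x * y}) (f_cont : continuous f).
Implicit Types (H K U V W X : set G).

Lemma iter_image_index n U V : compact_open_subgroup U -> compact_open_subgroup V ->
  finite_index (iter n f @` U) V.
Proof.
move=> [_ cU _] [sV _ oV].
by apply: compact_finite_index => //; exact: iter_image_compact.
Qed.

Lemma iter_image_index1 U V : compact_open_subgroup U -> compact_open_subgroup V ->
  finite_index (f @` U) V.
Proof. exact: (@iter_image_index 1). Qed.

Lemma displacement_indexE U : compact_open_subgroup U ->
  displacement_index f U = subgroup_index (f @` U) U.
Proof.
move=> coU; have [sU _ _] := coU.
by apply: subgroup_index_setIl; [exact: is_subgroup_image| |exact: iter_image_index1].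
Qed.

(** A compact open subgroup makes the set of displacement indices nonempty, so its least element
    exists and the default of [xget] is not taken. *)
Lemma scaleP U0 : compact_open_subgroup U0 ->
  (exists2 U, compact_open_subgroup U & displacement_index f U = scale f) /\
  (forall U, compact_open_subgroup U -> (scale f <= displacement_index f U)%N).
Proof.
move=> coU0; apply: (@xgetPex _ 0%N [set s |
    (exists2 U, compact_open_subgroup U & displacement_index f U = s) /\
    (forall U, compact_open_subgroup U -> s <= displacement_index f U)%N]).
pose P s := `[< exists2 U, compact_open_subgroup U & displacement_index f U = s >].
have exP : exists s, P s by exists (displacement_index f U0); apply/asboolP; exists U0.
have [s /asboolP [U coU Us] min_s] := ex_minnP exP.
exists s; split; first by exists U.
by move=> V coV; apply: min_s; apply/asboolP; exists V.
Qed.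

(** Passing from [f^n V] to [f^n U] costs a factor [[V : U]], and passing from cosets of [U] to
    cosets of [V] a factor [[U : V]]. *)
Lemma iter_index_mul n U V : compact_open_subgroup U -> compact_open_subgroup V ->
  (subgroup_index (iter n f @` V) V <=
   subgroup_index V U * subgroup_index U V * subgroup_index (iter n f @` U) U)%N.
Proof.
move=> coU coV; have [sU cU oU] := coU; have [sV cV oV] := coV.
have sfU : is_subgroup (iter n f @` U) := is_subgroup_image (iter_mulgM fM n) sU.
have VU : finite_index V U by exact: compact_finite_index.
have UV : finite_index U V by exact: compact_finite_index.
have [fin1 le1] := subgroup_index_image (iter_mulgM fM n) VU.
have [fin2 le2] := subgroup_index_trans sfU fin1 (iter_image_index n coU coU).
have [_ le3] := subgroup_index_trans sU fin2 UV.
apply: (leq_trans le3); rewrite mulnAC leq_mul2r; apply/orP; right.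
by apply: (leq_trans le2); rewrite leq_mul2r le1 orbT.
Qed.

(** Each further application of [f] costs at most a factor [[f U : U]], because [f (f^n U)] meets at
    most as many cosets of [f U] as [f^n U] meets of [U]. *)
Lemma iter_index_le n U : compact_open_subgroup U ->
  (subgroup_index (iter n f @` U) U <= displacement_index f U ^ n)%N.
Proof.
move=> coU; have [sU cU oU] := coU; rewrite displacement_indexE //.
have finU := iter_image_index _ coU coU.
have fsU : is_subgroup (f @` U) := is_subgroup_image fM sU.
elim: n => [|n IH].
  by rewrite expn0 image_id subgroup_indexxx.
have fiterE : iter n.+1 f @` U = f @` (iter n f @` U) by rewrite image_comp.
have [fin1 le1] := subgroup_index_image fM (finU n); rewrite fiterE.
have [_ le2] := subgroup_index_trans fsU fin1 (finU 1%N).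
apply: (leq_trans le2); rewrite expnSr leq_mul2r; apply/orP; right.
exact: leq_trans IH.
Qed.

Lemma scale_exp_le W n : compact_open_subgroup W ->
  (scale f ^ n <= subgroup_index W (staying f W n))%N.
Proof.
move=> coW; have [sW cW oW] := coW; have [_ min_scale] := scaleP coW.
have coS k := staying_compact_open fM f_cont k coW.
have finW k : finite_index W (staying f W k).
  by have [? _ ?] := coS k; exact: compact_finite_index.
elim: n => [|n IH].
  by apply: subgroup_index_gt0 => //; exists 1; exact: subgroup1.
have [sS cS oS] := coS n; have [sS' cS' oS'] := coS n.+1.
have SS' : staying f W n.+1 `<=` staying f W n by apply: staying_le; exact: leqnSn.
apply: leq_trans (subgroup_index_mul_le sW sS sS' SS' (@staying_sub _ _ _ _) (finW _)).
rewrite expnSr; apply: leq_mul => //; apply: leq_trans (min_scale _ (coS n)) _.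
rewrite displacement_indexE //; have finfS := iter_image_index1 (coS n) (coS n).
(* The displacement index of [X = W_{-n}] becomes the index in [X] of the meet of [f^-1 X] and [X],
   which is [W_{-n-1}]. *)
have [finp <-] := subgroup_index_preimage fM sS finfS.
have [_ <-] := subgroup_index_setI sS (is_subgroup_preimage fM sS) finp.
suff -> : f @^-1` staying f W n `&` staying f W n = staying f W n.+1 by [].
apply/seteqP; split=> x.
  by rewrite stayingS => -[sfx sx]; split=> //; have := sfx n (leqnn n); rewrite -iterSr.
by move=> sx; split; [exact: (@staying_iter _ _ _ 1) | exact: SS'].
Qed.

(** [[W : W_{-n}]] is bounded through [U] and the group [X] of points of [U] that are back in [U] at
    time [n]: [[U : X]] is the number of cosets of [U] meeting [f^n U], and the number of cosets of
    [W_{-n}] meeting [X] is bounded independently of [n]. *)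
Lemma tidy_above_lower_bound U : hausdorff_space G ->
  compact_open_subgroup U -> tidy_above f U ->
  exists C N, forall n, (N <= n)%N ->
    (scale f ^ n <= C * subgroup_index (iter n f @` U) U)%N.
Proof.
move=> hG coU tidyU; have [sU cU oU] := coU.
have [K cK hK] := homoclinic_compact fM hG f_cont coU tidyU.
have sL := homoclinic_subgroup fM hG f_cont coU.
have [W coW LW] := compact_open_hull hG sL cK hK coU.
have [sW cW oW] := coW.
(* [U_n] and [U_{-n}] decrease to [U_+] and [U_-], whose meet lies in [homoclinic], hence in [W]; by
   compactness the meet of [U_N] and [U_{-N}] lies in [W] for some [N]. *)
have [|n|x Ux|N NP] := @compact_decreasing_empty G U
    (fun n => (arriving f U n `&` staying f U n) `&` ~` W) cU.
- move=> n; apply: closedI; last exact: open_closedC.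
  apply: closedI; first exact: arriving_closed.
  exact: staying_closed (compact_open_closed coU).
- move=> x [[/arrivingS ax sx] nWx]; split=> //; split=> //.
  exact: (staying_le (leqnSn n) sx).
- apply: contrapT => nex; have {}nex n : arriving f U n x /\ staying f U n x /\ ~ W x.
    by apply: contrapT => nn; apply: nex; exists n => -[[? ?] ?]; apply: nn.
  have [_ [_]] := nex 0%N; apply; apply: LW; apply: backward_forward_homoclinic.
    by move=> n; have [] := nex n.
  by apply: forward_staying => n; have [_ []] := nex n.
have {}NP x : arriving f U N x -> staying f U N x -> W x.
  move=> ax sx; apply: contrapT => nWx.
  have : (U `&` ((arriving f U N `&` staying f U N) `&` ~` W)) x.
    by split; [exact: staying_sub sx | ].
  by rewrite NP.
pose WU := [set w * u | w in W & u in U].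
have cWU : compact WU by exact: compact_setM.
have coSW := staying_compact_open fM f_cont N coW; have [sSW cSW oSW] := coSW.
(* The factors account for passing from [W] to [U], for the first [N] steps and for the last [N]
   steps; [n >= N + N] makes room for both ends. *)
exists (subgroup_index W U *
  (subgroup_index U (staying f W N) * subgroup_index WU (staying f W N)))%N, (N + N)%N.
move=> n le_NNn; apply: leq_trans (scale_exp_le n coW) _.
have fin (A B : set G) : compact A -> compact_open_subgroup B -> finite_index A B.
  by move=> cA [? _ ?]; exact: compact_finite_index.
have coS := staying_compact_open fM f_cont n coW.
pose X := iter n f @^-1` U `&` U.
have sfU := is_subgroup_preimage (iter_mulgM fM n) sU.
have sX : is_subgroup X by exact: is_subgroupI.
have XU : X `<=` U by move=> x [].
have [finUfU eUfU] := subgroup_index_preimage (iter_mulgM fM n) sU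
                        (iter_image_index n coU coU).
have [finUX eUX] := subgroup_index_setI sU sfU finUfU.
have finX (B : set G) : compact_open_subgroup B -> finite_index X B.
  by move=> coB; have [] := subgroup_index_sub XU (fin _ _ cU coB).
have [_ le1] := subgroup_index_trans sU (fin _ _ cW coU) (fin _ _ cU coS).
have [_ le2] := subgroup_index_trans sX finUX (finX _ coS).
apply: (leq_trans le1); rewrite -mulnA leq_mul2l; apply/orP; right.
apply: (leq_trans le2); rewrite -/X eUX eUfU mulnC leq_mul2r; apply/orP; right.
have le_Nn : (N <= n)%N by apply: leq_trans le_NNn; exact: leq_addr.
pose m := (n - N)%N.
have nE : n = (m + N)%N by rewrite subnK.
have le_Nm : (N <= m)%N by rewrite -(leq_add2r N) -nE.
have coSm := staying_compact_open fM f_cont m coW; have [sSm cSm oSm] := coSm.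
(* Along the factorisation [x = l * (l^-1 * x)], the first factor remains in [homoclinic], hence in
   [W], while the second stays in [U] up to time [n]. *)
have XW x k : X x -> (k <= n)%N -> exists l w,
    [/\ W l, staying f U (n - k) w, arriving f U k w & iter k f x = l * w].
  move=> [Unx Ux] le_kn.
  have [l hl sl] := returning_homoclinic fM hG f_cont coU tidyU Ux Unx.
  exists (iter k f l), (iter k f (l^-1 * x)); split.
  - by apply: LW; exact: homoclinic_iter.
  - by apply: staying_iter; rewrite subnKC.
  - by exists (l^-1 * x) => //; exact: staying_le sl.
  - by rewrite -iter_mulgM // mulVKg.
(* At distance at least [N] from both ends, [w] has [N] steps in [U] before and after it, so [NP]
   puts it in [W]. *)
have middle x k : X x -> (N <= k)%N -> (k <= m)%N -> W (iter k f x).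
  move=> Xx le_Nk le_km.
  have le_kn : (k <= n)%N by rewrite nE (leq_trans le_km) ?leq_addr.
  have [l [w [Wl sw aw ->]]] := XW x k Xx le_kn.
  apply: subgroupM => //; apply: NP; first exact: arriving_le aw.
  by apply: staying_le sw; rewrite leq_subRL // addnC -leq_subRL // subKn.
(* On [X], staying in [W] until time [m] is thus a condition on the times up to [N]. *)
have staying_middle : staying f W m `&` X = staying f W N `&` X.
  apply/seteqP; split=> x [sx Xx]; split=> //; first exact: staying_le sx.
  move=> k le_km; have [/sx //|lt_Nk] := leqP k N.
  exact: middle (ltnW lt_Nk) le_km.
have fXm : iter m f @` X `<=` WU.
  move=> _ [x Xx <-]; have [l [w [Wl sw _ ->]]] := XW x m Xx (leq_subr _ _).
  by exists l => //; exists w => //; exact: staying_sub sw.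
have [finfX lefX] := subgroup_index_sub fXm (fin _ _ cWU coSW).
have [finpX epX] := subgroup_index_preimage (iter_mulgM fM m) sSW finfX.
have [_ le3] := subgroup_index_setI_le (finX _ coSm) finpX.
(* The times up to [m] and those from [m] to [n] are counted separately, the latter through the
   cosets of [W_{-N}] meeting [f^m X], a subset of [WU]. *)
rewrite {1}nE staying_add; apply: (leq_trans le3); rewrite epX; apply: leq_mul => //.
have [_ <-] := subgroup_index_setI sX sSm (finX _ coSm).
rewrite staying_middle; have [_ ->] := subgroup_index_setI sX sSW (finX _ coSW).
by have [] := subgroup_index_sub XU (fin _ _ cU coSW).
Qed.

Lemma scale_growth V : hausdorff_space G -> compact_open_subgroup V ->
  exists C D N, [/\ (0 < C)%N, (0 < D)%N & forall n, (N <= n)%N ->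
    (scale f ^ n <= C * subgroup_index (iter n f @` V) V)%N /\
    (subgroup_index (iter n f @` V) V <= D * scale f ^ n)%N].
Proof.
move=> hG coV; have [m tidyU] := tidy_above_staying fM f_cont coV.
have coU := staying_compact_open fM f_cont m coV.
have [C [N CP]] := tidy_above_lower_bound hG coU tidyU.
have [[U0 coU0 sU0] _] := scaleP coV.
(* The lower bound is carried from the tidy above [V_{-m}] to [V]; the upper one compares [V] with a
   minimizing [U0]. The successors make the constants positive. *)
exists (C * (subgroup_index (staying f V m) V * subgroup_index V (staying f V m))).+1,
  (subgroup_index V U0 * subgroup_index U0 V).+1, N; split=> // n le_Nn; split.
  apply: leq_trans (CP n le_Nn) _.
  apply: (@leq_trans (C * (subgroup_index (staying f V m) V *
    subgroup_index V (staying f V m)) * subgroup_index (iter n f @` V) V)).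
    by rewrite -mulnA leq_mul2l iter_index_mul ?orbT.
  by rewrite leq_mul2r leqnSn orbT.
apply: leq_trans (iter_index_mul n coU0 coV) _; rewrite -sU0.
by apply: leq_mul; [exact: leqnSn | exact: iter_index_le].
Qed.

End TrajectoryCounting.

(** * Limits of [n]-th roots *)

Section RootLimits.
Import Order.TTheory GRing.Theory Num.Theory.

Lemma cvg_root1 (R : realType) (c : R) :
  0 < c -> (fun n : nat => c `^ (n%:R^-1)) @ \oo --> (1 : R).
Proof.
move=> c0; rewrite /powR gt_eqF //.
rewrite -[X in _ --> X]expR0 -[X in _ --> expR X](mul0r (ln c)).
apply: (@continuous_cvg nat R R \oo _ (fun n => n%:R^-1 * ln c) expR (0 * ln c)).
  exact: continuous_expR.
apply: cvgM; last exact: cvg_cst.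
by rewrite -cvg_shiftS; exact: cvg_harmonic.
Qed.

(** Taking [n]-th roots squeezes the sequence between [C^(-1/n) * s] and [D^(1/n) * s]. *)
Lemma root_squeeze (R : realType) (s C D N : nat) (a : nat -> nat) :
  (0 < C)%N -> (0 < D)%N ->
  (forall n, (N <= n)%N -> (s ^ n <= C * a n)%N /\ (a n <= D * s ^ n)%N) ->
  (fun n : nat => (a n)%:R `^ (n%:R^-1) : R) @ \oo --> (s%:R : R).
Proof.
move=> C0 D0 aP.
have rootE (c : R) n : 0 <= c -> (0 < n)%N ->
    (c * s%:R ^+ n) `^ (n%:R^-1) = c `^ (n%:R^-1) * s%:R.
  move=> c0 n0; rewrite powRM ?exprn_ge0 // -powR_mulrn // -powRrM.
  by rewrite divff ?powRr1 // pnatr_eq0 -lt0n.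
have limE (c : R) : 0 < c ->
    (fun n : nat => c `^ (n%:R^-1) * s%:R) @ \oo --> (s%:R : R).
  move=> c0; rewrite -[X in _ --> X]mul1r.
  by apply: cvgM; [exact: cvg_root1 | exact: cvg_cst].
apply: (@squeeze_cvgr _ _ _ _ (fun n : nat => (C%:R^-1 : R) `^ (n%:R^-1) * s%:R)
  (fun n : nat => (D%:R : R) `^ (n%:R^-1) * s%:R)).
- near=> n.
  have n0 : (0 < n)%N by near: n; exact: nbhs_infty_gt.
  have [le1 le2] : (s ^ n <= C * a n)%N /\ (a n <= D * s ^ n)%N.
    by apply: aP; near: n; exact: nbhs_infty_ge.
  rewrite -!rootE ?invr_ge0 //; apply/andP; split.
    apply: ge0_ler_powR; rewrite ?invr_ge0 ?nnegrE ?mulr_ge0 ?invr_ge0 ?exprn_ge0 //.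
    by rewrite ler_pdivrMl ?ltr0n // -natrX -natrM ler_nat.
  apply: ge0_ler_powR; rewrite ?invr_ge0 ?nnegrE ?mulr_ge0 ?exprn_ge0 //.
  by rewrite -natrX -natrM ler_nat.
- by apply: limE; rewrite invr_gt0 ltr0n.
- by apply: limE; rewrite ltr0n.
Unshelve. all: by end_near.
Qed.

End RootLimits.

(** * The scale as a limit *)

Theorem proposition8p3 (R : realType) (G : topologicalGroupType)
    (G_td : totally_disconnected [set: G]) (G_lc : locally_compact [set: G])
    (alpha : {multiplicative G -> G}) (alpha_cont : continuous alpha)
    (V : set G) (V_co : compact_open_subgroup V) :
  (fun n : nat =>
     (subgroup_index (iter n alpha @` V) (V `&` iter n alpha @` V))%:R `^ (n%:R^-1) : R)
    @ \oo --> ((scale alpha)%:R : R).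
Proof.
have hG := totally_disconnected_hausdorff G_td.
have aM : {morph alpha : x y / (x * y)%g} := gmulfM.
have [C [D [N [C0 D0 P]]]] := scale_growth aM alpha_cont hG V_co.
(* The indices of the statement are the numbers of cosets of [V] meeting [alpha^n V], the form
   bounded by [scale_growth]. *)
have indexE n : subgroup_index (iter n alpha @` V) (V `&` iter n alpha @` V) =
                subgroup_index (iter n alpha @` V) V.
  have [sV _ _] := V_co.
  apply: (proj2 (subgroup_index_setI _ sV (iter_image_index alpha_cont n V_co V_co))).
  exact: is_subgroup_image (iter_mulgM aM n) sV.
under eq_fun do rewrite indexE.
exact: root_squeeze C0 D0 P.
Qed.
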